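(* Let $\mathcal A_1$ and $\mathcal A_2$ be two operator ideals. If $\mathcal A_1$ is surjective, or if $\mathcal A_2$ has the $\ell_1$-lifting property, then $$(\mathcal A_1\circ\mathcal A_2)^{sur}=\mathcal A_1^{sur}\circ\mathcal A_2^{sur}.$$
   Context: Operator ideals are quasi-normed operator ideals $(\mathcal A,\alpha)$ between Banach spaces. Composition: $T\in\mathcal A_1\circ\mathcal A_2(X,Y)$ iff $T=U\circ V$ with $V\in\mathcal A_2(X,Z)$, $U\in\mathcal A_1(Z,Y)$ for some Banach space $Z$. Surjective hull: let $B_X$ be the closed unit ball of $X$ and $q_X:\ell_1(B_X)\to X$, $q_X((\lambda_b)_{b\in B_X})=\sum_b\lambda_b b$; then $T\in\mathcal A^{sur}(X,Y)$ iff $T\circ q_X\in\mathcal A(\ell_1(B_X),Y)$. $\mathcal A$ is surjective if $\mathcal A^{sur}=\mathcal A$. $\ell_1$-lifting property of $(\mathcal A,\alpha)$: for every set $\Gamma$, Banach space $Y$ and $T\in\mathcal A(\ell_1(\Gamma),Y)$ there is $\hat T\in\mathcal A(\ell_1(\Gamma),\ell_1(B_Y))$ with $q_Y\circ\hat T=T$ and $\alpha(\hat T)=\alpha(T)$. *)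

(* Defs.v *)
From HB Require Import structures.
From mathcomp Require Import all_boot all_order all_algebra finmap complex.
From mathcomp Require Import all_classical all_reals all_analysis.
From mathcomp.analysis Require Import showcase.summability.

Set Implicit Arguments.
Unset Strict Implicit.
Unset Printing Implicit Defensive.

Import Order.TTheory GRing.Theory Num.Theory.
Import numFieldNormedType.Exports.

Local Open Scope classical_set_scope.
Local Open Scope ring_scope.

(** Banach spaces are taken over the real or the complex field. *)

Variant real_or_complex : numFieldType -> Prop :=
  | RealScalars (R : realType) : real_or_complex R
  | ComplexScalars (R : realType) : real_or_complex R[i].

Lemma scalar_supremum (K : numFieldType) (hK : real_or_complex K) (A : set K) :
  A !=set0 -> (forall x, A x -> 0 <= x) -> has_ubound A ->
  supremums A (supremum 0 A).
Proof.
move=> A0 Age0 [M AM].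
suff [s sA] : exists s, supremums A s.
  rewrite /supremum; case: eqP => [A0'|_]; last by apply: xgetPex; exists s.
  by move: A0; rewrite A0' => -[].
case: hK A A0 Age0 M AM => R A [a Aa] Age0 M AM.
  exists (sup A); split.
    by apply: ub_le_sup; exists M.
  by move=> y yA; apply: ge_sup => //; exists a.
have ReE x : A x -> x = (complex.Re x)%:C%C.
  by move=> /Age0; case: x => x y; rewrite lecE/= => /andP[/eqP -> _].
pose B : set R := (@complex.Re R) @` A.
have B0 : B !=set0 by exists (complex.Re a), a.
have ubB (z : R[i]) : ubound A z -> ubound B (complex.Re z).
  by move=> zA _ [x Ax <-]; move: (zA _ Ax); case: x {Ax} z {zA} => ? ? [? ?];
     rewrite lecE/= => /andP[].
exists ((sup B)%:C%C); split.
  move=> x Ax; rewrite (ReE _ Ax) lecR; apply: ub_le_sup.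
    by exists (complex.Re M); exact: ubB.
  by exists x.
move=> y yA.
have yE : y = (complex.Re y)%:C%C.
  have := yA _ Aa; rewrite (ReE _ Aa); case: y {yA} => u v.
  by rewrite lecE/= => /andP[/eqP -> _].
by rewrite yE lecR; apply: ge_sup => //; exact: ubB.
Qed.

Lemma scalar_complete (K : numFieldType) (hK : real_or_complex K)
    (F : set_system K^o) : ProperFilter F -> cauchy F -> cvg F.
Proof.
case: hK F => R; first exact: R_complete.
move=> F FF /cauchy_ballP Fc.
have part (p : R[i] -> R) : (forall z w, `|p z - p w|%:C%C <= `|z - w|) ->
    cvg (p @ F).
  move=> ple; apply: cauchy_cvg; apply/cauchy_ballP => e e0.
  have e0C : (0 : R[i]) < e%:C%C by rewrite ltcR.
  have [[U V]/= [FU FV] UV] := Fc _ e0C.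
  exists (p @` U, p @` V).
    by split => /=; [apply: filterS FU|apply: filterS FV] => z Uz; exists z.
  move=> [_ _] [/= [z Uz <-] [w Vw <-]].
  have := UV (z, w) (conj Uz Vw); rewrite /ball/= -ltcR.
  exact: le_lt_trans.
have cRe : cvg (@complex.Re R @ F).
  apply: part => -[a b] [c d]; apply: le_trans (normc_ge_Re _).
  by rewrite lecR.
have cIm : cvg (@complex.Im R @ F).
  apply: part => -[a b] [c d].
  have -> : `|(a +i* b)%C - (c +i* d)%C| =
      `|((b - d) +i* (c - a))%C|.
    rewrite !normc_def/=; congr (Num.sqrt _)%:C%C.
    by rewrite addrC -(opprB c a) sqrrN.
  exact: le_trans (normc_ge_Re _).
apply/cvg_ex.
exists ((lim (@complex.Re R @ F)) +i* (lim (@complex.Im R @ F)))%C.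
apply/cvgrPdist_lt => -[e e'] /=; rewrite ltcE/= => /andP[/eqP -> e0].
have e20 : 0 < e / 2 by rewrite divr_gt0.
move/cvgrPdist_lt : cRe => /(_ _ e20) Fre.
move/cvgrPdist_lt : cIm => /(_ _ e20) Fim.
near=> z.
rewrite [X in `|X|]complexE; apply: le_lt_trans (ler_normD _ _) _.
have -> : (e +i* 0)%C = (e / 2)%:C%C + (e / 2)%:C%C.
  by rewrite -raddfD/= -splitr.
have nR (x : R) : `|x%:C%C| = `|x|%:C%C.
  by rewrite normc_def/= expr0n addr0 sqrtr_sqr.
have ni : `|'i%C : R[i]| = 1 by rewrite normc_def/= expr0n expr1n add0r sqrtr1.
apply: ltrD; last rewrite normrM ni mul1r.
  rewrite nR ltcR; have -> : forall u v : R[i],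
    complex.Re (u - v) = complex.Re u - complex.Re v by move=> [? ?] [? ?].
  by near: z.
rewrite nR ltcR; have -> : forall u v : R[i],
  complex.Im (u - v) = complex.Im u - complex.Im v by move=> [? ?] [? ?].
by near: z.
Unshelve. all: by end_near. Qed.

(** The scalar field as a Banach space. *)
Definition scalar_line (K : numFieldType) (hK : real_or_complex K) : Type := K^o.

Section ScalarLine.
Variables (K : numFieldType) (hK : real_or_complex K).
HB.instance Definition _ := NormedModule.copy (scalar_line hK) K^o.
HB.instance Definition _ :=
  Uniform_isComplete.Build (scalar_line hK) (scalar_complete hK).
End ScalarLine.

Section AbsolutelySummable.
Variables (K : numFieldType) (Gamma : choiceType).

(** l1 Gamma is the space of absolutely summable families indexed by Gamma,
    i.e. those whose finite sums of absolute values are bounded; the norm is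
    their supremum. *)
Definition abs_sums (x : Gamma -> K) : set K :=
  range (partial_sum (fun g => `|x g|)).

Definition l1_norm (x : Gamma -> K) : K := supremum 0 (abs_sums x).

Definition absolutely_summable : {pred Gamma -> K} :=
  [pred x | `[< has_ubound (abs_sums x) >]].

End AbsolutelySummable.
Arguments absolutely_summable {K Gamma}.

(** The argument [hK] is what makes the norm on this type well defined. *)
Record l1 (K : numFieldType) (hK : real_or_complex K) (Gamma : choiceType) := L1 {
  l1_val :> Gamma -> K;
  l1_valP : l1_val \in absolutely_summable }.

Section L1.
Variables (K : numFieldType) (hK : real_or_complex K) (Gamma : choiceType).
Local Notation l1 := (l1 hK Gamma).
Local Notation l1_val := (@l1_val K hK Gamma).
Local Notation absolutely_summable := (@absolutely_summable K Gamma).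

HB.instance Definition _ := [isSub for l1_val].
HB.instance Definition _ := [Choice of l1 by <:].

Let sumsP (x : Gamma -> K) : reflect (exists M, forall A, partial_sum (fun g => `|x g|) A <= M)
  (x \in absolutely_summable).
Proof.
apply: (iffP (asboolP _)) => -[M xM]; exists M.
  by move=> A; apply: xM; exists A.
by move=> _ [A _ <-].
Qed.

Lemma partial_sum_ge0 (x : Gamma -> K) A : 0 <= partial_sum (fun g => `|x g|) A.
Proof. exact: sumr_ge0. Qed.

Lemma l1_norm_ub (x : Gamma -> K) A : x \in absolutely_summable ->
  partial_sum (fun g => `|x g|) A <= l1_norm x.
Proof.
move=> /asboolP xM.
have [ub _] : supremums (abs_sums x) (l1_norm x).
  apply: scalar_supremum => //; first by exists (partial_sum (fun g => `|x g|) A), A.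
  by move=> _ [B _ <-]; exact: partial_sum_ge0.
by apply: ub; exists A.
Qed.

Lemma l1_norm_le (x : Gamma -> K) M : (forall A, partial_sum (fun g => `|x g|) A <= M) ->
  x \in absolutely_summable /\ l1_norm x <= M.
Proof.
move=> xM; have xs : x \in absolutely_summable by apply/sumsP; exists M.
split=> //; move/asboolP : xs => xs.
have [_] : supremums (abs_sums x) (l1_norm x).
  apply: scalar_supremum => //; first by exists (partial_sum (fun g => `|x g|) fset0), fset0.
  by move=> _ [B _ <-]; exact: partial_sum_ge0.
by apply=> _ [A _ <-].
Qed.

Lemma partial_sumD (x y : Gamma -> K) A : partial_sum (fun g => `|x g + y g|) A <=
  partial_sum (fun g => `|x g|) A + partial_sum (fun g => `|y g|) A.
Proof.
by rewrite /partial_sum -big_split/=; apply: ler_sum => i _; exact: ler_normD.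
Qed.

Lemma partial_sumZ a (x : Gamma -> K) A : partial_sum (fun g => `|a * x g|) A =
  `|a| * partial_sum (fun g => `|x g|) A.
Proof.
by rewrite /partial_sum mulr_sumr; apply: eq_bigr => i _; rewrite normrM.
Qed.

Lemma l1_submod_closed : submod_closed absolutely_summable.
Proof.
split.
  apply/sumsP; exists 0 => A; rewrite /partial_sum big1// => i _.
  by rewrite normr0.
move=> a x y /sumsP[M xM] /sumsP[N yN]; apply/sumsP; exists (`|a| * M + N) => A.
apply: le_trans (partial_sumD _ _ A) _; apply: lerD => //.
by rewrite partial_sumZ ler_wpM2l.
Qed.

HB.instance Definition _ :=
  GRing.isSubmodClosed.Build _ _ absolutely_summable l1_submod_closed.
HB.instance Definition _ := [SubChoice_isSubLmodule of l1 by <:].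

Lemma l1_normD (x y : l1) : l1_norm (x + y) <= l1_norm x + l1_norm y.
Proof.
apply: (l1_norm_le _).2 => A; apply: le_trans (partial_sumD _ _ A) _.
by apply: lerD; apply: l1_norm_ub; exact: l1_valP.
Qed.

Lemma l1_norm_coord (x : Gamma -> K) g : x \in absolutely_summable -> `|x g| <= l1_norm x.
Proof.
move=> /(l1_norm_ub [fset g]%fset); apply: le_trans.
by rewrite /partial_sum -(big_seq_fsetE _ _ predT (fun g => `|x g|))/= big_seq_fset1.
Qed.

Lemma l1_norm_ge0 (x : Gamma -> K) : x \in absolutely_summable -> 0 <= l1_norm x.
Proof. by move=> /(l1_norm_ub fset0); apply: le_trans (partial_sum_ge0 _ _). Qed.

Lemma l1_normZ (a : K) (x : l1) : l1_norm (a *: x) = `|a| * l1_norm x.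
Proof.
have le b (y : l1) : l1_norm (b *: y) <= `|b| * l1_norm y.
  apply: (l1_norm_le _).2 => A; rewrite (partial_sumZ b y) ler_wpM2l//.
  exact: (l1_norm_ub A (l1_valP y)).
apply/eqP; rewrite eq_le le/=.
have [->|a0] := eqVneq a 0.
  by rewrite normr0 mul0r; exact: (l1_norm_ge0 (l1_valP (0 *: x))).
rewrite mulrC -ler_pdivlMr ?normr_gt0// mulrC -normfV.
by apply: le_trans _ (le a^-1 (a *: x)); rewrite scalerA mulVf// scale1r.
Qed.

Lemma l1_norm0_eq0 (x : l1) : l1_norm x = 0 -> x = 0.
Proof.
move=> x0; apply/val_inj/funext => g; apply/eqP; rewrite -normr_le0 -x0.
exact: (l1_norm_coord g (l1_valP x)).
Qed.

HB.instance Definition _ :=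
  Lmodule_isNormed.Build K l1 l1_normD l1_normZ l1_norm0_eq0.

Lemma l1_complete (F : set_system l1) : ProperFilter F -> cauchy F -> cvg F.
Proof.
move=> FF /cauchy_ballP Fc.
have Fe e : 0 < e -> \forall x \near F, \forall y \near F, `|x - y| < e.
  move=> e0; have [[U V]/= [FU FV] UV] := Fc _ e0.
  apply: filterS FU => x Ux; apply: filterS FV => y Vy.
  by have := UV (x, y) (conj Ux Vy); rewrite -ball_normE.
have coordB (g : Gamma) (x y : l1) : `|x g - y g| <= `|x - y|.
  exact: (l1_norm_coord g (l1_valP (x - y))).
have coord (g : Gamma) : cvg ((fun x : l1 => x g : K^o) @ F).
  apply: scalar_complete => //; apply/cauchy_ballP => e e0.
  have [[U V]/= [FU FV] UV] := Fc _ e0.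
  exists ((fun x : l1 => x g) @` U, (fun x : l1 => x g) @` V).
    by split => /=; [apply: filterS FU|apply: filterS FV] => z Uz; exists z.
  move=> [_ _] [/= [z Uz <-] [w Vw <-]].
  have := UV (z, w) (conj Uz Vw); rewrite -!ball_normE /=.
  exact: le_lt_trans (coordB _ _ _).
pose l g : K := lim ((fun x : l1 => x g : K^o) @ F).
have near_l (e : K) : 0 < e -> \forall x \near F, forall A : {fset Gamma},
    partial_sum (fun g => `|(x : l1) g - l g|) A <= e.
  move=> e0; have e20 : 0 < e / 2 by rewrite divr_gt0.
  apply: filterS (Fe _ e20) => x xF A.
  have c0 : 0 < e / 2 / (#|{: A}|%:R + 1) by rewrite divr_gt0// ltr_wpDl.
  have FA : \forall y \near F, forall g : A, `|l (val g) - (y : l1) (val g)|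
      <= e / 2 / (#|{: A}|%:R + 1).
    apply: filter_forall => g.
    by move/cvgrPdist_le : (coord (val g)); exact.
  have [y [xy yl]] := filter_ex (filterI xF FA).
  rewrite [e]splitr.
  apply: (@le_trans _ _ (partial_sum (fun g => `|x g - y g|) A +
    partial_sum (fun g => `|y g - l g|) A)).
    rewrite /partial_sum -big_split/=; apply: ler_sum => g _.
    by rewrite -[X in `|X|](subrKA (y (val g))); exact: ler_normD.
  apply: lerD.
    apply: le_trans (ltW xy).
    exact: (l1_norm_ub A (l1_valP (x - y))).
  apply: (@le_trans _ _ (\sum_(g : A) (e / 2 / (#|{: A}|%:R + 1)))).
    by apply: ler_sum => g _; rewrite distrC.
  rewrite sumr_const -[X in X <= _]mulr_natr -mulrA ler_piMr ?(ltW e20)//.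
  by rewrite mulrC ler_pdivrMr ?ltr_wpDl// mul1r lerDl.
have lP : l \in absolutely_summable.
  have [x xl] := filter_ex (near_l _ ltr01).
  have [xls _] := l1_norm_le xl.
  have -> : l = (x : Gamma -> K) - (fun g => x g - l g).
    by apply/funext => g /=; rewrite /GRing.add/= /GRing.opp/= subKr.
  by rewrite rpredB//; exact: l1_valP.
apply/cvg_ex; exists (L1 hK lP); apply/cvgrPdist_le => e e0.
apply: filterS (near_l _ e0) => x xl.
by rewrite distrC; exact: (l1_norm_le xl).2.
Qed.

HB.instance Definition _ := Uniform_isComplete.Build l1 l1_complete.

End L1.

Section Operators.
Variable K : numFieldType.

Definition bounded_operator (X Y : normedModType K) (T : X -> Y) : Prop :=
  linear T /\ continuous T.

Definition op_norm (X Y : normedModType K) (T : X -> Y) : K :=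
  supremum 0 [set `|T x| | x in [set x : X | `|x| <= 1]].

Definition unit_ball (X : normedModType K) : choiceType := {x : X | `|x| <= 1}.

(** An operator class assigns a set of maps X -> Y to each pair of Banach
    spaces. *)
Definition op_class := forall X Y : completeNormedModType K, set (X -> Y).

Definition op_comp (A1 A2 : op_class) : op_class := fun X Y =>
  [set T | exists (Z : completeNormedModType K) (U : Z -> Y) (V : X -> Z),
    [/\ A1 Z Y U, A2 X Z V & T = U \o V]].

End Operators.

Section Ideals.
Variables (K : numFieldType) (hK : real_or_complex K).
Implicit Types X Y Z W : completeNormedModType K.

(** Quasi-normed operator ideals, with Pietsch's normalization on the identity
    of the scalar field and a single quasi-norm constant for all components;
    the components need not be complete. The values of [ideal_norm] outside
    the ideal are irrelevant. *)
Record op_ideal := OpIdeal {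
  ideal_class :> op_class K ;
  ideal_norm : forall X Y, (X -> Y) -> K ;
  ideal_bounded : forall X Y (T : X -> Y),
    ideal_class T -> bounded_operator T ;
  ideal_id : ideal_class (@idfun (scalar_line hK)) ;
  ideal_add : forall X Y (S T : X -> Y),
    ideal_class S -> ideal_class T -> ideal_class (fun x => S x + T x) ;
  ideal_mul : forall X Y Z W (R : X -> Y) (T : Y -> Z) (S : Z -> W),
    bounded_operator R -> ideal_class T -> bounded_operator S ->
    ideal_class (S \o T \o R) ;
  ideal_norm_ge0 : forall X Y (T : X -> Y),
    ideal_class T -> 0 <= ideal_norm T ;
  ideal_norm0_eq0 : forall X Y (T : X -> Y),
    ideal_class T -> ideal_norm T = 0 -> T = cst 0 ;
  ideal_normZ : forall X Y (a : K) (T : X -> Y),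
    ideal_class T -> ideal_norm (fun x => a *: T x) = `|a| * ideal_norm T ;
  ideal_norm_add : exists2 kappa : K, 1 <= kappa &
    forall X Y (S T : X -> Y), ideal_class S -> ideal_class T ->
    ideal_norm (fun x => S x + T x) <= kappa * (ideal_norm S + ideal_norm T) ;
  ideal_norm_id : ideal_norm (@idfun (scalar_line hK)) = 1 ;
  ideal_norm_mul : forall X Y Z W (R : X -> Y) (T : Y -> Z) (S : Z -> W),
    bounded_operator R -> ideal_class T -> bounded_operator S ->
    ideal_norm (S \o T \o R) <= op_norm S * ideal_norm T * op_norm R }.

(** The map l1 (B_X) -> X sending x to the sum of the x_b b. The sum is
    the limit of the finite partial sums, as B_X is uncountable in general. *)
Definition quotient_map X (x : l1 hK (unit_ball X)) : X :=
  summability.sum (fun b : unit_ball X => x b *: val b).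

Definition surjective_hull (A : op_class K) : op_class K := fun X Y =>
  [set T | bounded_operator T /\
           A _ Y (T \o quotient_map (X := X))].

Definition surjective_class (A : op_class K) : Prop := surjective_hull A = A.

Definition l1_lifting_property (A : op_ideal) : Prop :=
  forall (Gamma : choiceType) Y (T : l1 hK Gamma -> Y), ideal_class A T ->
  exists That : l1 hK Gamma -> l1 hK (unit_ball Y),
    [/\ ideal_class A That, quotient_map (X := Y) \o That = T &
        ideal_norm A That = ideal_norm A T].

End Ideals.

(* Main.v *)
(** Let q_X : l1(B_X) -> X be the canonical surjection. If T q_X = U V with V in
    A2(l1(B_X), Z) and U in A1(Z, Y), then T maps X into the range of U. Give
    this range the quotient norm of Z / ker U, so that it is a Banach space W,
    U = j p with p : Z -> W and j : W -> Y, and T = j T'. As T' q_X = p V, the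
    operator T' lies in A2^sur; it is bounded because every x has a preimage
    under q_X of norm at most that of x. As q_W lifts through p to an operator
    L : l1(B_W) -> Z, one has j q_W = j p L = U L, so j lies in A1^sur.
    Conversely, let T = U V with U in A1^sur(Z, Y) and V in A2^sur(X, Z): either
    U is already in A1, or V q_X lifts to S : l1(B_X) -> l1(B_Z) in A2 and
    T q_X = (U q_Z) S. *)

Require Import Defs.
From mathcomp Require Import all_boot all_algebra.
From HB Require Import structures.
From mathcomp Require Import all_order finmap complex ring.
From mathcomp Require Import all_classical all_reals all_analysis.
From mathcomp.analysis Require Import showcase.summability.

Set Implicit Arguments.
Unset Strict Implicit.
Unset Printing Implicit Defensive.

Import Order.TTheory GRing.Theory Num.Theory.
Import numFieldNormedType.Exports.

Local Open Scope classical_set_scope.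
Local Open Scope ring_scope.

(** * Bounded operators and finite partial sums *)

Lemma bounded_operatorP (K : numFieldType) (X Y : normedModType K) (T : X -> Y) :
  bounded_operator T <->
  linear T /\ exists2 C : K, 0 < C & forall x, `|T x| <= C * `|x|.
Proof.
split=> -[lT].
  pose f : {linear X -> Y} := HB.pack T (GRing.isLinear.Build _ _ _ _ _ lT).
  move=> /(@linear_bounded_continuous _ _ _ f).2/linear_boundedP[M [Mr Mle]].
  split=> //; exists (`|M| + 1); first by rewrite ltr_wpDl.
  move=> x; apply: Mle.
  by rewrite (le_lt_trans (real_ler_norm _))// ltrDl.
move=> [C C0 CT]; split=> //.
pose f : {linear X -> Y} := HB.pack T (GRing.isLinear.Build _ _ _ _ _ lT).
apply: (@bounded_linear_continuous _ _ _ f); apply/linear_boundedP.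
exists C; split; first exact: gtr0_real.
by move=> r Cr x; apply: le_trans (CT x) _; rewrite ler_wpM2r// ltW.
Qed.

Lemma bounded_operator_id (K : numFieldType) (X : normedModType K) :
  bounded_operator (@idfun X).
Proof. by split=> // x; exact: cvg_id. Qed.

Lemma partial_sum_subset (I : choiceType) (M : zmodType) (u : I -> M)
    (A B : {fset I}) : (A `<=` B)%fset ->
  partial_sum u B = partial_sum u A + partial_sum u (B `\` A)%fset.
Proof.
move=> /fsubsetP AB; rewrite /partial_sum.
rewrite -!(big_seq_fsetE _ _ xpredT u) (big_fsetID _ (mem A)) /=.
congr (_ + _); apply: eq_fbigl => i; rewrite !inE.
  by have [/AB|] := boolP (i \in A); rewrite ?andbT ?andbF.
by rewrite andbC.
Qed.

#[local] Existing Instance totally_filter.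

(** * Operators on l1 given by bounded families *)

Section L1Map.
Variables (K : numFieldType) (hK : real_or_complex K) (Gamma : choiceType).
Variables (Z : completeNormedModType K).
Implicit Types (f : Gamma -> Z) (x : l1 hK Gamma).

(** Sends the unit vector at [g] to [f g]; [quotient_map] is the case where [f] is the inclusion of
    the unit ball. *)
Definition l1_map f x : Z := summability.sum (fun g => x g *: f g).

Lemma partial_sum_norm_le f M x (A : {fset Gamma}) : 0 <= M ->
  (forall g, `|f g| <= M) ->
  `|partial_sum (fun g => x g *: f g) A| <=
  partial_sum (fun g => `|x g|) A * M.
Proof.
move=> M0 fM; rewrite /partial_sum mulr_suml.
apply: le_trans (ler_norm_sum _ _ _) _; apply: ler_sum => g _.
by rewrite normrZ ler_wpM2l.
Qed.

(** [l1_norm x] is the supremum of the finite partial sums, so some [A] comes within [e] of it; less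
    than [e] is left for indices outside [A]. *)
Lemma l1_tail x (e : K) : 0 < e -> exists A : {fset Gamma},
  forall B, (A `<=` B)%fset -> partial_sum (fun g => `|x g|) (B `\` A)%fset < e.
Proof.
move=> e0.
have xs := l1_valP x.
have [A Ae] : exists A, l1_norm x < partial_sum (fun g => `|x g|) A + e.
  apply: contrapT => /forallNP Ae.
  have [|_ ] := @l1_norm_le K hK Gamma x (l1_norm x - e).
    move=> A; rewrite lerBrDr; move: (Ae A) => /negP.
    rewrite -real_leNgt// ger0_real ?(l1_norm_ge0 hK xs)//.
    by rewrite addr_ge0 ?(ltW e0)// partial_sum_ge0.
  by rewrite lerDl oppr_ge0 lt_geF.
exists A => B AB; have := l1_norm_ub hK B xs.
rewrite (partial_sum_subset _ AB) => xB.
by rewrite -(ltrD2l (partial_sum (fun g => `|x g|) A)); apply: le_lt_trans xB Ae.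
Qed.

(** Beyond a set [A] from [l1_tail], partial sums differ by at most the tail times the bound on [f],
    so they are Cauchy in the complete space [Z]. *)
Lemma l1_map_cvg f M x : (forall g, `|f g| <= M) ->
  partial_sum (fun g => x g *: f g) @ totally --> l1_map f x.
Proof.
move=> fM; apply/cauchy_cvgP; apply: cauchy_exP => e e0.
(* For empty [Gamma] the scalar [M] is arbitrary; |M| + 1 is a positive bound by which one can
   divide. *)
have [M0 {}fM] : 0 < `|M| + 1 /\ forall g, `|f g| <= `|M| + 1.
  split=> [|g]; first by rewrite ltr_wpDl.
  have fgM := fM g.
  by rewrite (le_trans fgM)// ger0_norm ?lerDl// (le_trans _ fgM).
have [A Ax] := @l1_tail x (e / (`|M| + 1)) (divr_gt0 e0 M0).
exists (partial_sum (fun g => x g *: f g) A); exists A => // B /= AB.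
rewrite -ball_normE/= distrC (partial_sum_subset _ AB) addrC addKr.
apply: le_lt_trans (partial_sum_norm_le _ _ (ltW M0) fM) _.
by rewrite -ltr_pdivlMr//; exact: Ax.
Qed.

Lemma l1_map_norm f M x : 0 <= M -> (forall g, `|f g| <= M) ->
  `|l1_map f x| <= M * `|x|.
Proof.
move=> M0 fM; apply/ler_addgt0Pl => e e0.
have /cvgrPdist_lt/(_ e e0)/filter_ex[A Ae] := @l1_map_cvg f M x fM.
rewrite -(subrK (partial_sum (fun g => x g *: f g) A) (l1_map f x)).
apply: le_trans (ler_normD _ _) _; apply: lerD; first exact: ltW.
apply: le_trans (partial_sum_norm_le _ _ M0 fM) _.
by rewrite mulrC ler_wpM2l//; exact: l1_norm_ub (l1_valP x).
Qed.

Lemma l1_map_linear f M : (forall g, `|f g| <= M) -> linear (l1_map f).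
Proof.
move=> fM a x y; apply: cvg_lim => //.
have -> : partial_sum (fun g => (a *: x + y) g *: f g) =
    (fun A => a *: partial_sum (fun g => x g *: f g) A +
              partial_sum (fun g => y g *: f g) A).
  apply/funext => A; rewrite /partial_sum scaler_sumr -big_split/=.
  by apply: eq_bigr => g _; rewrite scalerA -scalerDl.
by apply: cvgD; [apply: cvgZr|]; apply: l1_map_cvg fM.
Qed.

Lemma bounded_l1_map f M : (forall g, `|f g| <= M) ->
  bounded_operator (l1_map f).
Proof.
move=> fM; apply/bounded_operatorP; split; first exact: l1_map_linear fM.
exists (`|M| + 1); first by rewrite ltr_wpDl.
move=> x; apply: l1_map_norm => [|g]; first by rewrite addr_ge0.
have fgM := fM g.
by rewrite (le_trans fgM)// ger0_norm ?lerDl// (le_trans _ fgM).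
Qed.

(** [U] commutes with finite sums by linearity, and with their limit by continuity. *)
Lemma l1_map_comp (Y : completeNormedModType K) (U : Z -> Y) f M x :
  bounded_operator U -> (forall g, `|f g| <= M) ->
  U (l1_map f x) = summability.sum (fun g => x g *: U (f g)).
Proof.
move=> [lU cU] fM; apply/esym/cvg_lim => //.
pose u : {linear Z -> Y} := HB.pack U (GRing.isLinear.Build _ _ _ _ _ lU).
have -> : partial_sum (fun g => x g *: U (f g)) =
    U \o partial_sum (fun g => x g *: f g).
  apply/funext => A; rewrite /partial_sum/= -[RHS]/(u _) linear_sum.
  by apply: eq_bigr => g _; rewrite -[RHS]/(u _) linearZ_LR.
by apply: continuous_cvg; [exact: cU|exact: l1_map_cvg fM].
Qed.

End L1Map.

(** * Surjectivity of the canonical map *)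

Section QuotientMap.
Variables (K : numFieldType) (hK : real_or_complex K).
Variable X : completeNormedModType K.

(** The preimage is |x| times the unit vector at x / |x|. *)
Lemma quotient_map_surj (x : X) : exists2 xi : l1 hK (unit_ball X),
  quotient_map xi = x & `|xi| <= `|x|.
Proof.
(* For [x = 0] the inverse is 0 by convention, and the chosen point of the ball is the origin. *)
have b_subproof : `| `|x|^-1 *: x| <= 1.
  rewrite normrZ normfV normr_id.
  by have [->|x0] := eqVneq `|x| 0; rewrite ?mulr0// mulVf.
pose b : unit_ball X := exist (fun y : X => is_true (`|y| <= 1)) _ b_subproof.
pose xi (c : unit_ball X) : K := if c == b then `|x| else 0.
have sumE (M : zmodType) (u : unit_ball X -> M) (A : {fset unit_ball X}) :
    (forall c, c != b -> u c = 0) ->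
    partial_sum u A = if b \in A then u b else 0.
  move=> u0; rewrite /partial_sum -(big_seq_fsetE _ _ xpredT u)/=.
  case: ifPn => [bA|bA]; last first.
    by rewrite big_seq big1// => c cA; apply: u0; apply: contraNneq bA => <-.
  rewrite (big_fsetD1 b)//= big_seq big1 ?addr0// => c.
  by rewrite !inE => /andP[/u0].
have [xis xin] : xi \in absolutely_summable /\ l1_norm xi <= `|x|.
  apply: (l1_norm_le hK) => A; rewrite sumE => [|c cb].
    by rewrite /xi eqxx normr_id; case: ifP.
  by rewrite /xi (negbTE cb) normr0.
exists (L1 hK xis) => //; apply: cvg_lim => //.
apply: cvg_near_cst; exists [fset b]%fset => // A /=.
rewrite fsub1set => bA; rewrite sumE => [|c cb].
  rewrite bA /xi eqxx/= scalerA.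
  have [x0|x0] := eqVneq `|x| 0; last by rewrite mulfV// scale1r.
  by rewrite x0 mul0r scale0r; apply/esym/eqP; rewrite -normr_eq0 x0.
by rewrite /xi (negbTE cb) scale0r.
Qed.

End QuotientMap.

(** A positive complex number has zero imaginary part, which reduces the complex case to the
    Archimedean property of the reals. *)
Lemma exp_half_lt (K : numFieldType) (hK : real_or_complex K) (e : K) :
  0 < e -> exists n, 2^-1 ^+ n < e.
Proof.
have real_case (R : realType) (r : R) : 0 < r -> exists n, 2^-1 ^+ n < r.
  move=> r0; exists (Num.bound r^-1); rewrite exprVn -[ltRHS]invrK.
  rewrite ltf_pV2 ?posrE ?exprn_gt0 ?invr_gt0//.
  rewrite (@le_lt_trans _ _ (Num.bound r^-1)%:R)//.
    by rewrite ltW// archi_boundP// invr_ge0 ltW.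
  by rewrite -natrX ltr_nat ltn_expl.
case: hK e => R e; first exact: real_case.
case: e => r s; rewrite ltcE/= => /andP[/eqP -> /real_case[n nr]].
exists n; have -> : (2^-1 : R[i]) = (2^-1)%:C%C.
  by rewrite fmorphV/= rmorphMn/= rmorph1.
by rewrite -rmorphXn ltcR.
Qed.

(** * Quotient norm on the range of an operator *)

Section QuotientNorm.
Variables (K : numFieldType) (hK : real_or_complex K).
Variables (Z Y : normedModType K) (U : Z -> Y).

Definition fiber_bounds (y : Y) : set K :=
  [set l | 0 <= l /\ forall z, U z = y -> l <= `|z|].

(** The infimum of the norm over the fiber of [y], taken as the supremum of its
    nonnegative lower bounds so that [scalar_supremum] applies. *)
Definition quotient_norm (y : Y) : K := supremum 0 (fiber_bounds y).

Let quotient_norm_supremum z :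
  supremums (fiber_bounds (U z)) (quotient_norm (U z)).
Proof.
apply: scalar_supremum => //.
- by exists 0; split.
- by move=> l [].
- by exists `|z| => l [_]; apply.
Qed.

Lemma quotient_norm_le z : quotient_norm (U z) <= `|z|.
Proof. by apply: (quotient_norm_supremum z).2 => l [_]; apply. Qed.

Lemma le_quotient_norm l z : 0 <= l -> (forall z', U z' = U z -> l <= `|z'|) ->
  l <= quotient_norm (U z).
Proof. by move=> l0 lz; apply: (quotient_norm_supremum z).1. Qed.

Lemma quotient_norm_ge0 z : 0 <= quotient_norm (U z).
Proof. exact: le_quotient_norm. Qed.

(** Otherwise [e] would be a lower bound on the fiber, hence at most the quotient norm. The
    inequality is strict because the infimum need not be attained. *)
Lemma quotient_norm_lift z e : quotient_norm (U z) < e ->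
  exists2 z', U z' = U z & `|z'| < e.
Proof.
move=> Uze; apply: contrapT => nlift.
have e0 := le_lt_trans (quotient_norm_ge0 z) Uze.
suff : e <= quotient_norm (U z) by rewrite lt_geF.
apply: le_quotient_norm => [|z' z'E]; first exact: ltW.
rewrite real_leNgt ?(gtr0_real e0)//; apply/negP => z'e.
by apply: nlift; exists z'.
Qed.

End QuotientNorm.

(** The argument [hU] makes the range a submodule. *)
Definition operator_range (K : numFieldType) (Z Y : normedModType K)
    (U : Z -> Y) (hU : bounded_operator U) : {pred Y} :=
  [pred y | `[< range U y >]].

(** Isometrically the quotient of [Z] by the kernel of [U]. *)
Record range_space (K : numFieldType) (hK : real_or_complex K)
    (Z Y : normedModType K) (U : Z -> Y) (hU : bounded_operator U) := RangeSpace {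
  range_val :> Y;
  range_valP : range_val \in operator_range hU }.
Arguments range_val {K hK Z Y U hU}.

(** * The range as a Banach space *)

Section RangeSpace.
Variables (K : numFieldType) (hK : real_or_complex K).
Variables (Z : completeNormedModType K) (Y : normedModType K).
Variables (U : Z -> Y) (hU : bounded_operator U).
Local Notation range_space := (range_space hK hU).
Local Notation range_val := (@range_val K hK Z Y U hU).
Local Notation N := (quotient_norm U).

Let u : {linear Z -> Y} := HB.pack U (GRing.isLinear.Build _ _ _ _ _ hU.1).

HB.instance Definition _ := [isSub for range_val].
HB.instance Definition _ := [Choice of range_space by <:].

Lemma operator_range_submod_closed : submod_closed (operator_range hU).
Proof.
split; first by apply/asboolP; exists 0 => //; exact: (linear0 u).
move=> a _ _ /asboolP[z _ <-] /asboolP[w _ <-]; apply/asboolP.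
by exists (a *: z + w) => //; exact: hU.1.
Qed.

HB.instance Definition _ := GRing.isSubmodClosed.Build _ _ (operator_range hU)
  operator_range_submod_closed.
HB.instance Definition _ := [SubChoice_isSubLmodule of range_space by <:].

Lemma range_map_subproof z : U z \in operator_range hU.
Proof. by apply/asboolP; exists z. Qed.

Definition range_map (z : Z) : range_space := RangeSpace hK (range_map_subproof z).

Lemma range_map_surj (y : range_space) : exists z, range_map z = y.
Proof. by case: y => y yU; have /asboolP[z _ zy] := yU; exists z; apply/val_inj. Qed.

Lemma range_map_linear : linear range_map.
Proof. by move=> a x y; apply/val_inj => /=; exact: hU.1. Qed.

Let p : {linear Z -> range_space} :=
  HB.pack range_map (GRing.isLinear.Build _ _ _ _ _ range_map_linear).

Definition range_norm (y : range_space) : K := N y.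

Lemma range_norm_ge0 y : 0 <= range_norm y.
Proof. by have [z <-] := range_map_surj y; exact: (quotient_norm_ge0 hK). Qed.

(** Lifts of [x] and [y] within e/2 of the optimal norm add up to a lift of [x + y]. *)
Lemma range_normD (x y : range_space) :
  range_norm (x + y) <= range_norm x + range_norm y.
Proof.
have [[z <-] [w <-]] := (range_map_surj x, range_map_surj y).
apply/ler_addgt0Pl => e e0; have e20 : 0 < e / 2 by rewrite divr_gt0.
have [|z' z'E z'e] := @quotient_norm_lift K hK Z Y U z (N (U z) + e / 2).
  by rewrite ltrDl.
have [|w' w'E w'e] := @quotient_norm_lift K hK Z Y U w (N (U w) + e / 2).
  by rewrite ltrDl.
have -> : range_map z + range_map w = range_map (z' + w').
  by rewrite -[RHS]/(p _) linearD; congr (_ + _); apply/val_inj.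
apply: le_trans (quotient_norm_le hK U _) _.
apply: le_trans (ler_normD _ _) _.
by rewrite [e]splitr [leRHS]addrC addrACA; apply: lerD; exact: ltW.
Qed.

Lemma range_normZ (a : K) (x : range_space) :
  range_norm (a *: x) = `|a| * range_norm x.
Proof.
(* One inequality for all scalars suffices: the reverse one is its instance at the inverse of
   [a]. *)
have le b y : range_norm (b *: y) <= `|b| * range_norm y.
  have [z <-] := range_map_surj y.
  have [->|b0] := eqVneq b 0.
    have -> : 0 *: range_map z = range_map 0.
      by rewrite scale0r -[RHS]/(p _) linear0.
    by rewrite normr0 mul0r -(@normr0 _ Z); exact: (quotient_norm_le hK).
  rewrite -ler_pdivrMl ?normr_gt0//; apply: (le_quotient_norm hK) => // [|z' z'E].
    by rewrite mulr_ge0 ?invr_ge0// range_norm_ge0.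
  rewrite ler_pdivrMl ?normr_gt0// -normrZ.
  have -> : b *: range_map z = range_map (b *: z').
    by rewrite -[RHS]/(p _) linearZ_LR; congr (_ *: _); apply/val_inj.
  exact: (quotient_norm_le hK).
apply/eqP; rewrite eq_le le/=.
have [->|a0] := eqVneq a 0.
  by rewrite normr0 mul0r range_norm_ge0.
rewrite mulrC -ler_pdivlMr ?normr_gt0// mulrC -normfV.
by apply: le_trans _ (le a^-1 (a *: x)); rewrite scalerA mulVf// scale1r.
Qed.

(** If [C] bounds [U], then |y| / C is at most the norm of every preimage of [y]. This gives both
    definiteness of the norm and boundedness of the inclusion into [Y]. *)
Lemma range_val_bounded :
  exists2 C : K, 0 < C & forall y : range_space, `|(y : Y)| <= C * range_norm y.
Proof.
have [_ [C C0 CU]] := (bounded_operatorP U).1 hU.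
exists C => // y; have [z <-] := range_map_surj y.
rewrite -ler_pdivrMl//; apply: (le_quotient_norm hK) => // [|z' z'E].
  by rewrite mulr_ge0// invr_ge0 ltW.
by rewrite ler_pdivrMl//= -z'E.
Qed.

Lemma range_norm0_eq0 (x : range_space) : range_norm x = 0 -> x = 0.
Proof.
move=> x0; have [C _ /(_ x)] := range_val_bounded.
by rewrite x0 mulr0 normr_le0 => /eqP xE; apply/val_inj.
Qed.

HB.instance Definition _ :=
  Lmodule_isNormed.Build K range_space range_normD range_normZ range_norm0_eq0.

Lemma range_map_le z : `|range_map z| <= `|z|.
Proof. exact: (quotient_norm_le hK). Qed.

Lemma bounded_range_map : bounded_operator range_map.
Proof.
apply/bounded_operatorP; split; first exact: range_map_linear.
by exists 1 => // z; rewrite mul1r; exact: range_map_le.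
Qed.

Lemma bounded_range_val : bounded_operator (range_val : range_space -> Y).
Proof. by apply/bounded_operatorP; split=> //; exact: range_val_bounded. Qed.

Lemma range_map_lift (y : range_space) e : `|y| < e ->
  exists2 z, range_map z = y & `|z| < e.
Proof.
have [z <-] := range_map_surj y => /(quotient_norm_lift hK)[z' z'E z'e].
by exists z' => //; apply/val_inj.
Qed.

(* Centers [x n] of balls of radius [2^-n] lying in the Cauchy filter are lifted
   one increment at a time, with control of the norm, to a Cauchy sequence of
   [Z]; the image of its limit is the limit of the filter. *)
Lemma range_complete (F : set_system range_space) :
  ProperFilter F -> cauchy F -> cvg F.
Proof.
move=> FF /cauchyP Fc; pose h n : K := 2^-1 ^+ n.
have h0 n : 0 < h n by rewrite exprn_gt0// invr_gt0.
have hS n : h n = 2 * h n.+1 by rewrite /h exprS mulVKf.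
have [x xF] : {x : nat -> range_space & forall n, F (ball (x n) (h n))}.
  by apply: (@choice _ _ (fun n y => F (ball y (h n)))) => n; exact: Fc.
(* Two sets of a proper filter meet, so consecutive balls share a point [y]. *)
have dx n : `|x n.+1 - x n| < 2 * h n.
  have [y [/=]] := filter_ex (filterI (xF n) (xF n.+1)).
  rewrite -!ball_normE/= => yn yn1.
  rewrite -(subrKA y) (le_lt_trans (ler_normD _ _))// mulr2n mulrDl !mul1r.
  rewrite addrC; apply: ltrD; first by rewrite distrC.
  by rewrite (lt_trans yn1)// (hS n) mulr2n mulrDl !mul1r ltrDl.
have [d dP] : {d : nat -> Z & forall n,
    range_map (d n) = x n.+1 - x n /\ `|d n| < 2 * h n}.
  apply: (@choice _ _ (fun n y => range_map y = x n.+1 - x n /\ `|y| < 2 * h n)).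
  by move=> n; have [z] := range_map_lift (dx n); exists z.
have [z0 z0E] := range_map_surj (x 0%N).
pose z n := z0 + \sum_(i < n) d i.
have zS n : z n.+1 = z n + d n by rewrite /z big_ord_recr addrA.
have zE n : range_map (z n) = x n.
  elim: n => [|n IH]; first by rewrite /z big_ord0 addr0.
  by rewrite zS -[LHS]/(p _) linearD /= IH (dP n).1 addrC subrK.
(* The bound is the geometric sum of the [2 * h i] for n <= i < n + k, telescoped through 2 h(i) = 4
   h(i) - 4 h(i+1). *)
have zz n k : `|z (n + k)%N - z n| <= 4 * h n - 4 * h (n + k)%N.
  elim: k => [|k IH]; first by rewrite addn0 !subrr normr0.
  rewrite addnS zS addrAC (le_trans (ler_normD _ _))//.
  have -> : 4 * h n - 4 * h (n + k).+1 =
      (4 * h n - 4 * h (n + k)%N) + 2 * h (n + k)%N.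
    by rewrite (hS (n + k)%N); ring.
  by rewrite lerD// ltW// (dP _).2.
have /cvg_ex[l zl] : cvg (z @ \oo).
  apply/cauchy_cvgP; apply: cauchy_exP => e e0.
  have [n ne] := exp_half_lt hK (divr_gt0 e0 (ltr0Sn K 3)).
  exists (z n); exists n => // m /= nm.
  rewrite -ball_normE/= distrC -(subnKC nm) (le_lt_trans (zz _ _))//.
  rewrite (@le_lt_trans _ _ (4 * h n)) ?gerBl ?mulr_ge0 ?ltW//.
  by rewrite -ltr_pdivlMl// mulrC.
apply/cvg_ex; exists (range_map l); apply/cvgrPdist_lt => e e0.
have e20 : 0 < e / 2 by rewrite divr_gt0.
have [n ne] := exp_half_lt hK e20.
have [m [/= lm nm]] : exists m, `|l - z m| < e / 2 /\ (n <= m)%N.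
  move/cvgrPdist_lt : zl => /(_ _ e20) lz.
  have [m [? ?]] := filter_ex (filterI lz (nbhs_infty_ge n)).
  by exists m.
apply: filterS (xF m) => y; rewrite -ball_normE/= => xy.
rewrite -(subrKA (x m)) (le_lt_trans (ler_normD _ _))// [e]splitr ltrD//.
  rewrite -zE -[range_map l]/(p l) -[range_map (z m)]/(p (z m)) -linearB.
  by rewrite (le_lt_trans (range_map_le _)).
rewrite (lt_trans xy)// (le_lt_trans _ ne)//.
by rewrite ler_wiXn2l ?invr_ge0 ?invf_le1 ?ler1n.
Qed.

HB.instance Definition _ :=
  Uniform_isComplete.Build range_space range_complete.

End RangeSpace.

(** * The two inclusions between the composed hulls *)

Section Hull.
Variables (K : numFieldType) (hK : real_or_complex K).
Implicit Types (A : op_ideal hK) (X Y Z : completeNormedModType K).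

Lemma ideal_mull A X Y Z (T : X -> Y) (S : Y -> Z) :
  ideal_class A T -> bounded_operator S -> ideal_class A (S \o T).
Proof. by move=> AT bS; exact: ideal_mul (bounded_operator_id X) AT bS. Qed.

Lemma ideal_mulr A X Y Z (R : X -> Y) (T : Y -> Z) :
  bounded_operator R -> ideal_class A T -> ideal_class A (T \o R).
Proof. by move=> bR AT; exact: ideal_mul bR AT (bounded_operator_id Z). Qed.

Lemma bounded_operator_comp X Y Z (S : Y -> Z) (T : X -> Y) :
  bounded_operator S -> bounded_operator T -> bounded_operator (S \o T).
Proof.
move=> [lS cS] [lT cT]; split; first by move=> a x y /=; rewrite lT lS.
by move=> x; apply: continuous_comp; [exact: cT|exact: cS].
Qed.

Lemma surjective_hull_range_val A X Y (U : X -> Y) (hU : bounded_operator U) :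
  ideal_class A U ->
  @surjective_hull K hK A _ Y (range_val (hK := hK) (hU := hU)).
Proof.
move=> AU; pose W : completeNormedModType K := range_space hK hU.
have bp := bounded_range_map hK hU.
split; first exact: bounded_range_val.
(* Lifts of norm at most 1 may fail to exist; any constant above 1, here 2, allows a bounded
   choice. *)
have [f fP] : {f : unit_ball W -> X &
    forall b, range_map hK hU (f b) = val b /\ `|f b| <= 2}.
  apply: (@choice _ _ (fun b y => range_map hK hU y = val b /\ `|y| <= 2)) => b.
  have [|z] := @range_map_lift K hK X Y U hU (val b) 2.
    by rewrite (le_lt_trans (valP b))// ltr1n.
  by exists z; split=> //; exact: ltW.
(* [l1_map f] lifts the canonical surjection onto [W] through [range_map]. *)
have -> : range_val \o quotient_map (X := W) = U \o l1_map (hK := hK) f.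
  apply/funext => x /=.
  rewrite -[RHS]/(range_val (range_map hK hU (l1_map f x))).
  congr range_val; rewrite (@l1_map_comp K hK _ X W _ f 2 x bp) => [|b].
    by congr summability.sum; apply/funext => b; rewrite (fP b).1.
  exact: (fP b).2.
apply: ideal_mulr AU; apply: (@bounded_l1_map K hK _ X f 2) => b.
exact: (fP b).2.
Qed.

Lemma surjective_hull_comp_sub (A1 A2 : op_ideal hK) X Y :
  @surjective_hull K hK (op_comp A1 A2) X Y `<=`
  @op_comp K (surjective_hull hK A1) (surjective_hull hK A2) X Y.
Proof.
move=> T [bT [Z [U [V [A1U A2V TUV]]]]].
have bU := ideal_bounded A1U.
have bV := ideal_bounded A2V.
have TE xi : T (quotient_map xi) = U (V xi) by have /(congr1 (@^~ xi)) := TUV.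
pose W : completeNormedModType K := range_space hK bU.
have TW x : T x \in operator_range bU.
  have [xi <- _] := quotient_map_surj hK x.
  by apply/asboolP; exists (V xi).
pose V' x : W := RangeSpace hK (TW x).
have V'E xi : V' (quotient_map xi) = range_map hK bU (V xi).
  by apply/val_inj; exact: TE.
exists W, range_val, V'; split; [exact: surjective_hull_range_val| |by []].
split.
  apply/bounded_operatorP; split.
    by move=> a x y; apply/val_inj => /=; exact: bT.1.
  (* Evaluating at a preimage [xi] of [x] with norm at most that of [x] makes the bound [C] of [V]
     serve for [V']. *)
  have [_ [C C0 VC]] := (bounded_operatorP V).1 bV.
  exists C => // x; have [xi <- xix] := quotient_map_surj hK x.
  rewrite V'E (le_trans (range_map_le hK bU _))// (le_trans (VC _))//.
  by rewrite ler_wpM2l// ltW.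
have -> : V' \o quotient_map (X := X) = range_map hK bU \o V by exact/funext.
exact: ideal_mull (bounded_range_map hK bU).
Qed.

Lemma comp_surjective_hull_sub (A1 A2 : op_ideal hK) X Y :
  surjective_class hK A1 \/ l1_lifting_property A2 ->
  @op_comp K (surjective_hull hK A1) (surjective_hull hK A2) X Y `<=`
  @surjective_hull K hK (op_comp A1 A2) X Y.
Proof.
move=> A12 _ [Z [U [V [[bU A1U] [bV A2V] ->]]]].
split; first exact: bounded_operator_comp.
case: A12 => [A1s|A2l].
  (* Surjectivity puts [U] itself in [A1], so [Z] stays the middle space. *)
  exists Z, U, (V \o quotient_map (X := X)); split => //.
  by rewrite -A1s; split.
(* [W] lifts the composite of [V] with the canonical surjection, so l1 over the ball of [Z] becomes
   the middle space. *)
have [W [A2W VW _]] := A2l _ _ _ A2V.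
exists (l1 hK (unit_ball Z)), (U \o quotient_map (hK := hK) (X := Z)), W.
split=> //.
by rewrite -[RHS]compA VW.
Qed.

End Hull.

Theorem theorem4p5 (K : numFieldType) (hK : real_or_complex K)
    (A1 A2 : op_ideal hK) :
  surjective_class hK A1 \/ l1_lifting_property A2 ->
  surjective_hull hK (op_comp A1 A2) =
  op_comp (surjective_hull hK A1) (surjective_hull hK A2).
Proof.
move=> A12; apply: functional_extensionality_dep => X.
apply: functional_extensionality_dep => Y; apply/seteqP; split.
  exact: surjective_hull_comp_sub.
exact: comp_surjective_hull_sub.
Qed.
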